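(* Let $\mathfrak{g}$ be a unimodular Lie algebra with trivial center which carries a K-contact structure. Then $\mathfrak{g}$ is isomorphic to either $\mathfrak{sl}(2,\mathbb{R})$ or $\mathfrak{su}(2)$.
   Context: All Lie algebras are real and finite-dimensional. A contact form on a Lie algebra $\mathfrak{g}$ of dimension $2n+1$ is $\eta\in\mathfrak{g}^*$ with $\eta\wedge(d\eta)^n\neq0$, where $d\eta(x,y)=-\eta([x,y])$. Its Reeb vector is the unique $\xi\in\mathfrak{g}$ with $\eta(\xi)=1$ and $d\eta(\xi,\cdot)=0$. A metric contact structure on $\mathfrak{g}$ is a triple $(\eta,g,\Phi)$ where $\eta$ is a contact form with Reeb vector $\xi$, $g$ is an inner product on $\mathfrak{g}$ and $\Phi\in\operatorname{End}(\mathfrak{g})$, such that $\eta=g(\xi,\cdot)$, $d\eta(x,y)=2g(x,\Phi y)$ for all $x,y\in\mathfrak{g}$, and $\Phi^2=-\operatorname{Id}+\eta\otimes\xi$. It is a K-contact structure if $\operatorname{ad}_\xi$ is skew-symmetric with respect to $g$. A Lie algebra is unimodular if $\operatorname{tr}(\operatorname{ad}_x)=0$ for all $x$. *)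

(* Defs.v *)
From HB Require Import structures.
From mathcomp Require Import all_boot all_order all_fingroup all_algebra.
From mathcomp Require Import ring complex.

Set Implicit Arguments.
Unset Strict Implicit.
Unset Printing Implicit Defensive.

Import Order.TTheory GRing.Theory Num.Theory.
Local Open Scope ring_scope.

HB.mixin Record isLieAlgebra (R : nzRingType) L of GRing.Lmodule R L := {
  lie : L -> L -> L ;
  lie_linearl : forall y, linear (lie^~ y) ;
  lie_linearr : forall x, linear (lie x) ;
  liexx : forall x, lie x x = 0 ;
  lie_jacobi : forall x y z,
    lie x (lie y z) + lie y (lie z x) + lie z (lie x y) = 0
}.

#[short(type="lieAlgType")]
HB.structure Definition LieAlgebra (R : nzRingType) :=
  {L of isLieAlgebra R L & GRing.Lmodule R L}.

#[short(type="finDimLieAlgType")]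
HB.structure Definition FinDimLieAlgebra (R : nzRingType) :=
  {L of isLieAlgebra R L & Vector R L}.

Definition lie_isomorphic (R : nzRingType) (g h : lieAlgType R) : Prop :=
  exists f : {linear g -> h},
    bijective f /\ (forall x y, f (lie x y) = lie (f x) (f y)).

Section MatrixCommutator.
Variables (R : comNzRingType) (n : nat).
Implicit Types (a : R) (A B C : 'M[R]_n).

Definition mxcomm A B : 'M[R]_n := A *m B - B *m A.

Lemma mxcommDl A A' B : mxcomm (A + A') B = mxcomm A B + mxcomm A' B.
Proof. by rewrite /mxcomm mulmxDl mulmxDr opprD addrACA. Qed.

Lemma mxcommDr A B B' : mxcomm A (B + B') = mxcomm A B + mxcomm A B'.
Proof. by rewrite /mxcomm mulmxDl mulmxDr opprD addrACA. Qed.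

Lemma mxcommZl a A B : mxcomm (a *: A) B = a *: mxcomm A B.
Proof. by rewrite /mxcomm -scalemxAl -scalemxAr scalerBr. Qed.

Lemma mxcommZr a A B : mxcomm A (a *: B) = a *: mxcomm A B.
Proof. by rewrite /mxcomm -scalemxAl -scalemxAr scalerBr. Qed.

Lemma mxcommxx A : mxcomm A A = 0.
Proof. exact: subrr. Qed.

Lemma mxcomm_jacobi A B C :
  mxcomm A (mxcomm B C) + mxcomm B (mxcomm C A) + mxcomm C (mxcomm A B) = 0.
Proof.
rewrite /mxcomm !mulmxBr !mulmxBl !mulmxA !opprB.
set a := A *m B *m C; set b := A *m C *m B; set c := B *m C *m A.
set d := C *m B *m A; set e := B *m A *m C; set f := C *m A *m B.
by apply/matrixP=> i j; rewrite !mxE; ring.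
Qed.

Lemma mxtrace_comm A B : \tr (mxcomm A B) = 0.
Proof. by rewrite raddfB /= mxtrace_mulC subrr. Qed.

End MatrixCommutator.

Section SpecialLinear.
Variables (R : comNzRingType) (n : nat).

Definition sl_pred : {pred 'M[R]_n} := fun A => \tr A == 0.

Record sl := Sl { sl_val :> 'M[R]_n; _ : sl_val \in sl_pred }.

HB.instance Definition _ := [isSub for sl_val].
HB.instance Definition _ := [Choice of sl by <:].

Lemma sl_submod_closed : submod_closed sl_pred.
Proof.
split=> [|a A B]; rewrite !unfold_in ?mxtrace0// => /eqP A0 /eqP B0.
by rewrite mxtraceD mxtraceZ A0 B0 mulr0 addr0.
Qed.

HB.instance Definition _ := GRing.isSubmodClosed.Build R _ sl_pred sl_submod_closed.
HB.instance Definition _ := [SubChoice_isSubLmodule of sl by <:].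

Fact sl_lie_subproof (A B : sl) : mxcomm (sl_val A) (sl_val B) \in sl_pred.
Proof. by rewrite unfold_in mxtrace_comm. Qed.

Definition sl_lie (A B : sl) : sl := Sl (sl_lie_subproof A B).

Fact sl_lie_linearl B : linear (sl_lie^~ B).
Proof. by move=> a A A'; apply: val_inj; rewrite /= mxcommDl mxcommZl. Qed.

Fact sl_lie_linearr A : linear (sl_lie A).
Proof. by move=> a B B'; apply: val_inj; rewrite /= mxcommDr mxcommZr. Qed.

Fact sl_liexx A : sl_lie A A = 0.
Proof. by apply: val_inj; rewrite /= mxcommxx. Qed.

Fact sl_lie_jacobi A B C :
  sl_lie A (sl_lie B C) + sl_lie B (sl_lie C A) + sl_lie C (sl_lie A B) = 0.
Proof. by apply: val_inj; rewrite /= mxcomm_jacobi. Qed.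

HB.instance Definition _ := isLieAlgebra.Build R sl
  sl_lie_linearl sl_lie_linearr sl_liexx sl_lie_jacobi.

End SpecialLinear.

(* The coefficients are complex, but su(n) is a Lie algebra over the reals: the
   scalar action is restricted along R -> R[i], so it is not the one inherited
   from 'M[R[i]]_n. *)
Section SpecialUnitary.
Local Open Scope complex_scope.
Local Open Scope sesquilinear_scope.
Variables (R : rcfType) (n : nat).

Definition su_pred : {pred 'M[R[i]]_n} :=
  fun A => (A ^t* == - A) && (\tr A == 0).

Record su := Su { su_val :> 'M[R[i]]_n; _ : su_val \in su_pred }.

HB.instance Definition _ := [isSub for su_val].
HB.instance Definition _ := [Choice of su by <:].

Lemma su_zmod_closed : zmod_closed su_pred.
Proof.
split=> [|A B].
  by rewrite unfold_in mxtrace0 trmx0 map_mx0 oppr0 !eqxx.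
rewrite !unfold_in => /andP[/eqP A1 /eqP A2] /andP[/eqP B1 /eqP B2].
by rewrite [\tr _]raddfB /= A2 B2 subr0 eqxx andbT linearB /= map_mxB A1 B1 opprD.
Qed.

HB.instance Definition _ := GRing.isZmodClosed.Build _ su_pred su_zmod_closed.
HB.instance Definition _ := [SubChoice_isSubZmodule of su by <:].

Fact su_scale_subproof (a : R) (A : su) : a%:C *: su_val A \in su_pred.
Proof.
case: A => A /=; rewrite !unfold_in => /andP[/eqP A1 /eqP A2].
rewrite linearZ /= map_mxZ A1 mxtraceZ A2 mulr0 eqxx andbT.
by rewrite [X in X *: _](_ : _ = a%:C) ?scalerN//; exact: conjc_real.
Qed.

Definition su_scale (a : R) (A : su) : su := Su (su_scale_subproof a A).

Fact su_scaleA a b A : su_scale a (su_scale b A) = su_scale (a * b) A.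
Proof. by apply: val_inj; rewrite /= scalerA rmorphM. Qed.

Fact su_scale1 : left_id 1 su_scale.
Proof. by move=> A; apply: val_inj; rewrite /= rmorph1 scale1r. Qed.

Fact su_scaleDr : right_distributive su_scale +%R.
Proof. by move=> a A B; apply: val_inj; rewrite /= scalerDr. Qed.

Fact su_scaleDl A : {morph su_scale^~ A : a b / a + b}.
Proof. by move=> a b; apply: val_inj; rewrite /= rmorphD scalerDl. Qed.

HB.instance Definition _ := GRing.Zmodule_isLmodule.Build R su
  su_scaleA su_scale1 su_scaleDr su_scaleDl.

Fact su_lie_subproof (A B : su) : mxcomm (su_val A) (su_val B) \in su_pred.
Proof.
case: A B => [A pA] [B pB] /=; move: pA pB.
rewrite !unfold_in => /andP[/eqP A1 _] /andP[/eqP B1 _].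
rewrite mxtrace_comm eqxx andbT /mxcomm linearB /= !trmx_mul map_mxB !map_mxM.
by rewrite A1 B1 !mulmxN !mulNmx !opprK opprB.
Qed.

Definition su_lie (A B : su) : su := Su (su_lie_subproof A B).

Fact su_lie_linearl B : linear (su_lie^~ B).
Proof. by move=> a A A'; apply: val_inj; rewrite /= mxcommDl mxcommZl. Qed.

Fact su_lie_linearr A : linear (su_lie A).
Proof. by move=> a B B'; apply: val_inj; rewrite /= mxcommDr mxcommZr. Qed.

Fact su_liexx A : su_lie A A = 0.
Proof. by apply: val_inj; rewrite /= mxcommxx. Qed.

Fact su_lie_jacobi A B C :
  su_lie A (su_lie B C) + su_lie B (su_lie C A) + su_lie C (su_lie A B) = 0.
Proof. by apply: val_inj; rewrite /= mxcomm_jacobi. Qed.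

HB.instance Definition _ := isLieAlgebra.Build R su
  su_lie_linearl su_lie_linearr su_liexx su_lie_jacobi.

End SpecialUnitary.

Section ExteriorForms.
Variables (R : fieldType) (V : lmodType R).

(* A k-form is represented by its values on k vectors.  Neither multilinearity
   nor alternation is part of the type: every form used below is obtained from
   an alternating multilinear one by [wedge], which preserves both. *)
Definition form_of_degree (k : nat) := ('I_k -> V) -> R.

Definition wedge k l (a : form_of_degree k) (b : form_of_degree l) :
    form_of_degree (k + l) :=
  fun v => (k`! * l`!)%:R^-1 * \sum_(s : 'S_(k + l)) (-1) ^+ s *
    a (fun i => v (s (lshift l i))) * b (fun j => v (s (rshift k j))).

(* [m.+1 * d] is convertible to [d + m * d], so the recursion needs no cast. *)
Fixpoint wedge_exp d (a : form_of_degree d) (m : nat) :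
    form_of_degree (m * d) :=
  if m is m'.+1 then wedge a (@wedge_exp d a m') else fun=> 1.

End ExteriorForms.

Arguments wedge_exp {R V d} a m _.

Section LieAlgebraNotions.
Variables (R : fieldType) (g : finDimLieAlgType R).

Definition ad (x : g) : 'End(g) := linfun (lie x).

Definition endo_trace (f : 'End(g)) : R :=
  \tr (passmx.mxof (vbasis {:g}) (vbasis {:g}) f).

Definition unimodular : Prop := forall x : g, endo_trace (ad x) = 0.

Definition trivial_center : Prop :=
  forall x : g, (forall y : g, lie x y = 0) -> x = 0.

Definition dform (eta : {scalar g}) (x y : g) : R := - eta (lie x y).

Definition contact_form (eta : {scalar g}) : Prop :=
  exists n : nat, \dim {:g} = (1 + n * 2)%N /\
    exists v, wedge (fun u : 'I_1 -> g => eta (u 0))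
                (wedge_exp (fun u : 'I_2 -> g => dform eta (u 0) (u 1)) n) v != 0.

Definition reeb_vector (eta : {scalar g}) (xi : g) : Prop :=
  eta xi = 1 /\ (forall y, dform eta xi y = 0).

End LieAlgebraNotions.

Section KContact.
Variables (R : realFieldType) (g : finDimLieAlgType R).

Definition metric_contact (eta : {scalar g}) (xi : g) (m : {dot g for idfun})
    (Phi : 'End(g)) : Prop :=
  [/\ contact_form eta,
      reeb_vector eta xi,
      forall x, eta x = m xi x,
      forall x y, dform eta x y = 2 * m x (Phi y)
    & forall x, Phi (Phi x) = - x + eta x *: xi].

Definition K_contact (eta : {scalar g}) (m : {dot g for idfun})
    (Phi : 'End(g)) : Prop :=
  exists xi : g, metric_contact eta xi m Phi /\
    (forall x y, m (ad xi x) y = - m x (ad xi y)).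

End KContact.

(* Main.v *)
From HB Require Import structures.
Require Import Defs.
From mathcomp Require Import all_boot all_order all_algebra.
From mathcomp Require Import ring lra complex.
From mathcomp Require Import reals.
Set Implicit Arguments.
Unset Strict Implicit.
Unset Printing Implicit Defensive.
Import Order.TTheory GRing.Theory Num.Theory.
Local Open Scope ring_scope.

(** Let xi be the Reeb vector, A = ad xi, and k = ker A its centralizer.  The
    proof has two halves: k is the line spanned by xi, and a Lie algebra with
    such a xi is three-dimensional.

    The centralizer.  Since A is skew and nonzero (the center is trivial), the
    Killing functional s = tr (A o ad _) satisfies s xi = tr (A o A) < 0.
    Invariance of the trace gives s [z, y] = 0 for z in k, so s restricted to k
    is a character, and sigma = s / s xi takes the same value as eta at xi.
    Join eta to sigma by the line alpha_t = eta + t delta with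
    delta = sigma - eta.  In a unimodular algebra the top form
    alpha ^ (d alpha)^n is an invariant polynomial function of alpha, and when
    alpha_t is contact delta is tangent to its coadjoint orbit, because
    delta xi = 0; so this polynomial is constant along the line
    and sigma is contact as well.  But d sigma vanishes on k x g, hence k is a
    line.  In place of the top form, the text uses the determinant of the
    bilinear form alpha_t [x, y] + s x * s y: its derivative in t is controlled
    by Jacobi's formula (det_pencil_const), and tangency to the orbit expresses
    the variation as the action of a traceless derivation ad z
    (nondegenerate_deform).  The conclusion is centralizer_xi.

    The dimension.  Being skew, A is diagonalizable over the complex numbers
    with imaginary eigenvalues i nu (skew_spectral).  The compatible
    endomorphism Phi gives, for every weight nu != 0 that occurs, a weight
    vector e with [e, conj e] a nonzero multiple of xi
    (noncommuting_weight_pair): thus e, conj e and xi span a copy of sl2, and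
    its ladder relations apply to g.  Take the largest weight lam.  A positive
    weight vector is then killed by e, and since weights below - lam do not
    occur its string is short, so its weight is lam or lam / 2
    (highest_weight).  Half of lam is excluded by the triple attached to lam / 2:
    the string of e under it would have dimension 5, but it meets the zero
    weight space, which is the line of xi, and so stops early.  For the weight
    lam itself, subtracting a multiple of e leaves a vector killed by both e
    and conj e, that is zero.  So g is spanned by xi and the real and
    imaginary parts of e, and the sign of the last bracket decides between
    sl(2, R) and su(2). *)

(** * Determinants along a line of matrices *)

Lemma deriv_prod (R : comNzRingType) (I : finType) (f : I -> {poly R}) :
  (\prod_i f i)^`() = \sum_i (f i)^`() * \prod_(j | j != i) f j.
Proof.
have H (r : seq I) : uniq r -> (\prod_(i <- r) f i)^`() =
    \sum_(i <- r) (f i)^`() * \prod_(j <- r | j != i) f j.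
  elim: r => [|a r IH] /=; first by rewrite !big_nil derivC.
  move=> /andP[ar ur]; rewrite !big_cons derivM IH // eqxx /=.
  congr (_ * _ + _).
    by rewrite big_seq [RHS]big_seq_cond; apply: eq_bigl => j;
       case: eqP => [->|]; rewrite ?(negPf ar) ?andbT.
  rewrite mulr_sumr !big_seq; apply: eq_bigr => i ir.
  rewrite big_cons; have -> : a != i by apply: contraNneq ar => ->.
  by rewrite mulrCA.
by rewrite H // index_enum_uniq.
Qed.

(** Jacobi's formula: expand each determinant in which a single row has been
    derived along that row. *)
Lemma deriv_det (R : comNzRingType) n (P : 'M[{poly R}]_n) :
  (\det P)^`() = \tr (map_mx deriv P *m \adj P).
Proof.
pose Q i := \matrix_(k, j) if k == i then (P k j)^`() else P k j.
transitivity (\sum_i \det (Q i)).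
  rewrite (raddf_sum deriv) /determinant exchange_big /=; apply: eq_bigr => s _.
  have derivMsign (b : bool) (p : {poly R}) : ((-1) ^+ b * p)^`() = (-1) ^+ b * p^`().
    by case: b; rewrite ?mulN1r ?mul1r ?derivN.
  rewrite derivMsign -mulr_sumr deriv_prod; congr (_ * _); apply: eq_bigr => i _.
  rewrite [RHS](bigD1 i) //= !mxE eqxx; congr (_ * _).
  by apply: eq_bigr => j /negPf ji; rewrite mxE ji.
apply: eq_bigr => i _; rewrite (expand_det_row _ i) !mxE; apply: eq_bigr => j _.
rewrite !mxE eqxx; congr (_ * _); rewrite /cofactor; congr (_ * \det _).
by apply/matrixP => k l; rewrite !mxE eq_sym (negPf (neq_lift _ _)).
Qed.

Lemma poly_ext (R : numFieldType) (p : {poly R}) : (forall t, p.[t] = 0) -> p = 0.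
Proof.
move=> p0; apply/eqP; apply: contraT => pn0.
have rs_uniq : uniq [seq (i%:R : R) | i <- iota 0 (size p)].
  by rewrite map_inj_uniq ?iota_uniq //; apply: mulrIn; rewrite oner_eq0.
have := max_poly_roots pn0 _ rs_uniq; rewrite size_map size_iota ltnn => -> //.
by apply/allP => x _; apply/eqP.
Qed.

(** At parameters where A + t B is invertible, Jacobi's formula reads
    D' = D tr ((A + t B)^-1 B) = 0 for D t = det (A + t B); elsewhere D itself is
    zero.  Hence the polynomial D D' vanishes, and D is constant. *)
Lemma det_pencil_const (R : numFieldType) n (A B : 'M[R]_n) :
  (forall t, A + t *: B \in unitmx -> \tr (invmx (A + t *: B) *m B) = 0) ->
  \det (A + B) = \det A.
Proof.
move=> trB.
pose P : 'M[{poly R}]_n := map_mx polyC A + 'X *: map_mx polyC B.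
have PE t : map_mx (horner_eval t) P = A + t *: B.
  by apply/matrixP => i j; rewrite !mxE /horner_eval !hornerE.
have DE t : (\det P).[t] = \det (A + t *: B).
  by rewrite -[LHS]/(horner_eval t _) -det_map_mx PE.
have dP : map_mx deriv P = map_mx polyC B.
  by apply/matrixP => i j; rewrite !mxE derivD derivC derivM derivX derivC mulr0 addr0 add0r mul1r.
have /eqP : \det P * (\det P)^`() = 0.
  apply: poly_ext => t; rewrite hornerM deriv_det DE.
  have [->|nz] := eqVneq (\det (A + t *: B)) 0; first by rewrite mul0r.
  have u : A + t *: B \in unitmx by rewrite unitmxE unitfE.
  rewrite -[X in _ * X]/(horner_eval t _) -trace_map_mx map_mxM map_mx_adj PE dP.
  have -> : map_mx (horner_eval t) (map_mx polyC B) = B.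
    by apply/matrixP => i j; rewrite !mxE /horner_eval hornerC.
  have := trB t u; rewrite /invmx u -scalemxAl mxtraceZ mxtrace_mulC => /eqP.
  by rewrite mulf_eq0 invr_eq0 (negPf nz) /= => /eqP ->; rewrite mulr0.
have e1 : A + B = A + 1 *: B by rewrite scale1r.
have e0 : A = A + 0 *: B by rewrite scale0r addr0.
rewrite e1 [in RHS]e0 -!DE mulf_eq0 => /orP[/eqP->|/eqP dD]; first by rewrite !horner0.
have -> : \det P = ((\det P)`_0)%:P; last by rewrite !hornerC.
apply/polyP => [[|i]]; rewrite coefC //=.
have := congr1 (fun p : {poly R} => p`_i) dD; rewrite coef_deriv coef0 => /eqP.
by rewrite mulrn_eq0 /= => /eqP.
Qed.

(** * Deforming a bilinear form by traceless endomorphisms *)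

Section Trace.
Variables (F : fieldType) (V : vectType F).
Import passmx.

Lemma mxtrace_mxof (e b : (\dim {:V}).-tuple V) (f : 'End(V)) :
  basis_of {:V} e -> basis_of {:V} b -> \tr (mxof e e f) = \tr (mxof b b f).
Proof.
move=> eB bB.
have -> : mxof e e f = mxof e b \1 *m mxof b e f.
  by rewrite -mxof_comp // comp_lfun1r.
by rewrite mxtrace_mulC -mxof_comp // comp_lfun1l.
Qed.
End Trace.

Section Endo.
Variables (F : fieldType) (g : finDimLieAlgType F).
Import passmx.
Lemma endo_trace_mulC (f h : 'End(g)) : endo_trace (f \o h)%VF = endo_trace (h \o f)%VF.
Proof.
by rewrite /endo_trace !(mxof_comp _ _ (vbasisP _)) mxtrace_mulC.
Qed.
Lemma endo_traceD (f h : 'End(g)) : endo_trace (f + h) = endo_trace f + endo_trace h.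
Proof. by rewrite /endo_trace linearD /= mxtraceD. Qed.
Lemma endo_traceZ a (f : 'End(g)) : endo_trace (a *: f) = a * endo_trace f.
Proof. by rewrite /endo_trace linearZ /= mxtraceZ. Qed.
End Endo.

Section Bilin.
Variables (F : fieldType) (V : lmodType F).
Definition bilinear_form (b : V -> V -> F) :=
  (forall y, scalar (b^~ y)) /\ (forall x, scalar (b x)).
Definition left_nondegenerate (b : V -> V -> F) :=
  forall x, (forall y, b x y = 0) -> x = 0.
End Bilin.

Section Pencil.
Variables (F : numFieldType) (g : vectType F).
Import passmx.
Local Notation e := (vbasis {:g}).
Local Notation eB := (vbasisP {:g}).

Definition gram (b : g -> g -> F) : 'M_(\dim {:g}) := \matrix_(i, j) b e`_i e`_j.

Lemma scalar_sumZ (f : g -> F) : scalar f -> forall n (c : 'I_n -> F) (w : 'I_n -> g),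
  f (\sum_i c i *: w i) = \sum_i c i * f (w i).
Proof.
move=> fl n c w.
have f0 : f 0 = 0.
  by have := fl 1 0 0; rewrite scaler0 addr0 mul1r -{1}[f 0]add0r => /addIr.
elim/big_rec2: _ => //= i y1 y2 _ IH.
by rewrite fl IH.
Qed.

Lemma gramE b x : bilinear_form b -> forall y,
  b x y = (rVof e x *m gram b *m (rVof e y)^T) 0 0.
Proof.
move=> [bl br] y; rewrite [in LHS](coord_basis eB (memvf x)) [in LHS](coord_basis eB (memvf y)).
rewrite (scalar_sumZ (br _)) mxE; apply: eq_bigr => j _.
rewrite (scalar_sumZ (bl _)) !mxE mulrC; congr (_ * _).
by apply: eq_bigr => i _; rewrite !mxE.
Qed.

Lemma gram_unit b : bilinear_form b -> left_nondegenerate b <-> gram b \in unitmx.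
Proof.
move=> bb; split=> [nd|u x bx0].
- rewrite -row_free_unit -kermx_eq0; apply/eqP/row_matrixP => i; rewrite row0.
  have := row i (kermx (gram b)); set v := row i _ => _.
  have vG : v *m gram b = 0 by apply/sub_kermxP; rewrite row_sub.
  suff /eqP : vecof e v = 0 by rewrite vecof_eq0 ?eB // => /eqP.
  by apply: nd => y; rewrite (gramE _ bb) vecofK ?eB // vG mul0mx mxE.
- apply/eqP; rewrite -(rVof_eq0 eB) -[rVof e x](mulmxK u); apply/eqP.
  suff -> : rVof e x *m gram b = 0 by rewrite mul0mx.
  apply/rowP => j; have := bx0 e`_j; rewrite (gramE _ bb) (rVofE eB) trmx_delta.
  by rewrite -colE !mxE.
Qed.

Lemma nondegenerate_dual b (l : g -> F) : bilinear_form b -> left_nondegenerate b -> scalar l ->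
  exists z, forall y, b z y = l y.
Proof.
move=> bb /(gram_unit bb) u ls.
exists (vecof e ((\row_j l e`_j) *m invmx (gram b))) => y.
rewrite (gramE _ bb) vecofK ?eB // mulmxKV // mxE.
rewrite [in RHS](coord_basis eB (memvf y)) (scalar_sumZ ls).
by apply: eq_bigr => i _; rewrite !mxE mulrC.
Qed.

(** The infinitesimal change of variables Z acts on Gram matrices by
    G |-> Z G + G Z^T, whose relative trace is 2 tr Z. *)
Lemma gram_derivation b (Z : 'End(g)) : bilinear_form b ->
  gram (fun x y => b (Z x) y + b x (Z y)) =
  mxof e e Z *m gram b + gram b *m (mxof e e Z)^T.
Proof.
move=> bb; have [bl br] := bb.
have ZE (i : 'I_(\dim {:g})) : Z e`_i = \sum_k mxof e e Z i k *: e`_k.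
  rewrite [LHS](coord_basis eB (memvf _)); apply: eq_bigr => k _.
  by rewrite !mxE /= vecof_delta.
apply/matrixP => i j; rewrite !mxE; congr (_ + _).
  rewrite ZE (scalar_sumZ (bl _)).
  by apply: eq_bigr => k _; rewrite [gram _ _ _]mxE.
rewrite ZE (scalar_sumZ (br _)).
by apply: eq_bigr => k _; rewrite mulrC [gram _ _ _]mxE [in RHS]mxE.
Qed.

(** If, wherever b + t c is nondegenerate, the direction c comes from a
    traceless infinitesimal change of variables, then the discriminant of
    b + t c does not depend on t. *)
Lemma nondegenerate_deform b c : bilinear_form b -> bilinear_form c ->
  (forall t, let bt x y := b x y + t * c x y in left_nondegenerate bt ->
    exists2 Z : 'End(g), \tr (mxof e e Z) = 0 &
      forall x y, c x y = bt (Z x) y + bt x (Z y)) ->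
  left_nondegenerate b -> left_nondegenerate (fun x y => b x y + c x y).
Proof.
move=> bb cb H nb.
have sb t : bilinear_form (fun x y => b x y + t * c x y).
  have [[bl br] [cl cr]] := (bb, cb).
  by split=> [y|x] a u v /=; rewrite ?bl ?br ?cl ?cr !mulrDr; ring.
have gt t : gram (fun x y => b x y + t * c x y) = gram b + t *: gram c.
  by apply/matrixP => i j; rewrite !mxE.
have sb1 : bilinear_form (fun x y => b x y + c x y).
  have [[bl br] [cl cr]] := (bb, cb).
  by split=> [y|x] a u v /=; rewrite ?bl ?br ?cl ?cr; ring.
have g1 : gram (fun x y => b x y + c x y) = gram b + gram c.
  by apply/matrixP => i j; rewrite !mxE.
apply/(gram_unit sb1); rewrite g1 unitmxE det_pencil_const ?unitfE.
  by rewrite -unitfE -unitmxE; apply/(gram_unit bb).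
move=> t; rewrite -gt => u.
have [Z trZ cE] := H t ((gram_unit (sb t)).2 u).
set G := gram _ in u *.
have -> : gram c = mxof e e Z *m G + G *m (mxof e e Z)^T.
  by rewrite -gram_derivation //; apply/matrixP => i j; rewrite !mxE.
rewrite mulmxDr mulKmx // mxtraceD mxtrace_tr mxtrace_mulC mulmxK //.
by rewrite trZ addr0.
Qed.

End Pencil.

(** * Inner products and skew endomorphisms *)

Section Inner.
Variables (R : realFieldType) (V : lmodType R) (m : {dot V for idfun}).

Lemma dotC x y : m x y = m y x.
Proof. by rewrite (hermitian_subproof (s := m)) expr0 mul1r. Qed.
Lemma dotDr x y z : m x (y + z) = m x y + m x z.
Proof. exact: (linearD (m x)). Qed.
Lemma dotZr a x y : m x (a *: y) = a * m x y.
Proof. exact: (linearZr_LR m). Qed.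
Lemma dotDl x y z : m (x + y) z = m x z + m y z.
Proof. by rewrite dotC dotDr !(dotC z). Qed.
Lemma dotZl a x y : m (a *: x) y = a * m x y.
Proof. by rewrite dotC dotZr dotC. Qed.
Lemma dotNr x y : m x (- y) = - m x y.
Proof. by rewrite -scaleN1r dotZr mulN1r. Qed.
Lemma dotNl x y : m (- x) y = - m x y.
Proof. by rewrite dotC dotNr dotC. Qed.
Lemma dot0r x : m x 0 = 0.
Proof. by rewrite -(scale0r 0) dotZr mul0r. Qed.
Lemma dot0l x : m 0 x = 0.
Proof. by rewrite dotC dot0r. Qed.
Lemma dot_sumr I (r : seq I) (P : pred I) (F : I -> V) x :
  m x (\sum_(i <- r | P i) F i) = \sum_(i <- r | P i) m x (F i).
Proof. by elim/big_rec2: _ => [|i y z _ <-]; rewrite ?dot0r ?dotDr. Qed.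
Lemma dot_suml I (r : seq I) (P : pred I) (F : I -> V) x :
  m (\sum_(i <- r | P i) F i) x = \sum_(i <- r | P i) m (F i) x.
Proof. by rewrite dotC dot_sumr; apply: eq_bigr => i _; rewrite dotC. Qed.
Lemma dot_gt0 x : x != 0 -> 0 < m x x.
Proof. exact: neq0_dnorm_gt0. Qed.
Lemma dot_ge0 x : 0 <= m x x.
Proof. by have [->|/dot_gt0/ltW//] := eqVneq x 0; rewrite dot0l. Qed.
Lemma dot_eq0 x : (m x x == 0) = (x == 0).
Proof.
apply/eqP/eqP => [|->]; rewrite ?dot0l // => h.
by apply/eqP; apply: contraTT isT => /dot_gt0; rewrite h ltxx.
Qed.
Lemma dot_ext x y : (forall z, m z x = m z y) -> x = y.
Proof.
move=> h; apply/eqP; rewrite -subr_eq0 -dot_eq0 dotDr dotNr h subrr //.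
Qed.
End Inner.

Section Orthonormal.
Variables (R : rcfType) (V : vectType R) (m : {dot V for idfun}).
Import passmx.

(** Gram-Schmidt, one vector at a time. *)
Lemma orthonormal_family k : (k <= \dim {:V})%N ->
  exists e : nat -> V, forall i j, (i < k)%N -> (j < k)%N -> m (e i) (e j) = (i == j)%:R.
Proof.
elim: k => [|k IH] kd; first by exists (fun=> 0).
have [e eE] := IH (ltnW kd).
pose U := <<[seq e i | i <- iota 0 k]>>%VS.
have [v vU] : exists v, v \notin U.
  have /subvPn [v _ vU] : ~~ ({:V} <= U)%VS; last by exists v.
  apply/negP => /dimvS /(leq_trans kd); rewrite ltnNge.
  by rewrite (leq_trans (dim_span _)) // size_map size_iota.
pose w := v - \sum_(i < k) m v (e i) *: e i.
have w0 : w != 0.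
  apply: contraNneq vU => /eqP; rewrite subr_eq0 => /eqP ->.
  apply: rpred_sum => i _; apply: rpredZ; apply: memv_span.
  by apply/mapP; exists (val i); rewrite ?mem_iota /=.
have we i : (i < k)%N -> m w (e i) = 0.
  move=> ik; rewrite dotDl dotNl dot_suml (bigD1 (Ordinal ik)) //= dotZl eE // eqxx mulr1.
  rewrite big1 ?addr0 ?subrr // => j ji; rewrite dotZl eE // -val_eqE /= in ji *.
  by rewrite (negPf ji) mulr0.
pose c := (Num.sqrt (m w w))^-1.
have cc : m (c *: w) (c *: w) = 1.
  have p := dot_gt0 m w0.
  rewrite dotZl dotZr mulrA -invfM -expr2 sqr_sqrtr ?ltW // mulVf //; lra.
exists (fun i => if i == k then c *: w else e i) => i j.
rewrite !ltnS [(i <= k)%N]leq_eqVlt [(j <= k)%N]leq_eqVlt.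
case: (eqVneq i k) => [->|ik] /=; case: (eqVneq j k) => [->|jk] /=; rewrite ?eqxx //.
- by move=> _ jlt; rewrite dotZl we // mulr0.
- by move=> ilt _; rewrite dotZr dotC we // mulr0 [i == k](negPf ik).
- exact: eE.
Qed.

Lemma orthonormal_basis : exists e : (\dim {:V}).-tuple V,
  [/\ basis_of {:V} e, forall i j : 'I_(\dim {:V}), m e`_i e`_j = (i == j)%:R
    & forall (i : 'I_(\dim {:V})) v, coord e i v = m v e`_i].
Proof.
have [f fE] := orthonormal_family (leqnn _).
pose e := [tuple f i | i < \dim {:V}].
have eE (i : 'I_(\dim {:V})) : e`_i = f i by rewrite -tnth_nth tnth_mktuple.
have on (i j : 'I_(\dim {:V})) : m e`_i e`_j = (i == j)%:R by rewrite !eE fE.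
have fr : free e.
  apply/freeP => c c0 i; have := congr1 (m e`_i) c0.
  rewrite dot0r dot_sumr (bigD1 i) //= dotZr on eqxx mulr1 big1 ?addr0 // => j ji.
  by rewrite dotZr on eq_sym (negPf ji) mulr0.
have eB : basis_of {:V} e by rewrite basisEfree fr subvf size_tuple leqnn.
exists e; split=> // i v; rewrite [in RHS](coord_basis eB (memvf v)).
rewrite dot_suml (bigD1 i) //= dotZl on eqxx mulr1 big1 ?addr0 // => j ji.
by rewrite dotZl on (negPf ji) mulr0.
Qed.

End Orthonormal.

Section Skew.
Variables (R : rcfType) (V : vectType R) (m : {dot V for idfun}) (A : 'End(V)).
Hypothesis A_skew : forall x y, m (A x) y = - m x (A y).
Import passmx.

(** In an orthonormal basis f, tr (A o A) = - sum_i m (A f_i) (A f_i). *)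
Lemma skew_sqr_trace (e : (\dim {:V}).-tuple V) : basis_of {:V} e -> A != 0 ->
  \tr (mxof e e (A \o A)%VF) < 0.
Proof.
move=> eB A0; have [f [fB fon fc]] := orthonormal_basis m.
rewrite (mxtrace_mxof _ eB fB) /mxtrace.
have E (i : 'I_(\dim {:V})) : mxof f f (A \o A)%VF i i = - m (A f`_i) (A f`_i).
  by rewrite !mxE /= lfunE /= vecof_delta fc A_skew.
rewrite (eq_bigr _ (fun i _ => E i)) sumrN oppr_lt0 lt_neqAle sumr_ge0 ?andbT; last first.
  by move=> i _; apply: dot_ge0.
rewrite eq_sym; apply: contraNneq A0 => /eqP.
rewrite psumr_eq0 => [/allP z|i _]; last exact: dot_ge0.
rewrite -(mxof_eq0 fB fB); apply/eqP/row_matrixP => i; rewrite row0 rowE mul_mxof vecof_delta.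
have := z i (mem_index_enum _); rewrite /= dot_eq0 => /eqP ->.
by rewrite linear0.
Qed.

End Skew.

Section SkewMatrix.
Variables (R : rcfType).
Local Notation toC := (real_complex R).

Lemma Re_sum I (r : seq I) (P : pred I) (F : I -> R[i]) :
  complex.Re (\sum_(i <- r | P i) F i) = \sum_(i <- r | P i) complex.Re (F i).
Proof. by apply: big_morph => [[? ?] [? ?]|]. Qed.
Lemma Im_sum I (r : seq I) (P : pred I) (F : I -> R[i]) :
  complex.Im (\sum_(i <- r | P i) F i) = \sum_(i <- r | P i) complex.Im (F i).
Proof. by apply: big_morph => [[? ?] [? ?]|]. Qed.
Lemma Re_mulr (x : R[i]) y : complex.Re (x * toC y) = complex.Re x * y.
Proof. by case: x => a b /=; rewrite mulr0 subr0. Qed.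
Lemma Im_mulr (x : R[i]) y : complex.Im (x * toC y) = complex.Im x * y.
Proof. by case: x => a b /=; rewrite mulr0 add0r. Qed.

Variables (n : nat) (M : 'M[R]_n).
Hypothesis M_skew : M^T = - M.

(** A real skew matrix is normal over the complex numbers, hence diagonalizable;
    skew-hermitian symmetry makes the eigenvalues imaginary. *)
Lemma skew_mx_spectral : exists (W : 'M[R[i]]_n) (nu : 'I_n -> R),
  W \in unitmx /\ W *m map_mx toC M = diag_mx (\row_j Complex 0 (nu j)) *m W.
Proof.
pose Mc := map_mx toC M.
have McE : map_mx Num.conj (Mc^T) = - Mc.
  apply/matrixP => i j; rewrite !mxE.
  have := congr1 (fun B : 'M_n => B i j) M_skew; rewrite !mxE => ->.
  by rewrite [LHS]conjc_real rmorphN.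
have nM : Mc \is normalmx by apply/normalmxP; rewrite McE mulmxN mulNmx.
have /orthomx_spectralP := nM.
set W := spectralmx Mc; set D := spectral_diag Mc => ME.
have Wun : W \is unitarymx := spectral_unitarymx _.
have Wu : W \in unitmx := spectral_unit _.
have WM : W *m Mc = diag_mx D *m W by rewrite [in LHS]ME !mulmxA mulmxV // mul1mx.
exists W, (fun j => complex.Im (D 0 j)); split=> //.
rewrite WM; congr (diag_mx _ *m _); apply/rowP => j; rewrite mxE.
have : W *m Mc *m invmx W = diag_mx D by rewrite WM mulmxK.
rewrite invmx_unitary // => WMW.
have := congr1 (fun B : 'M_n => map_mx Num.conj B^T) WMW.
rewrite !trmx_mul !map_mxM McE trmxCK /= mulNmx mulmxN mulmxA WMW.
move=> /(congr1 (fun B : 'M_n => B j j)); rewrite !mxE eqxx !mulr1n.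
case: (D 0 j) => a b /= [] h; have -> : a = 0 by lra.
by [].
Qed.

End SkewMatrix.

(** The pair (p, q) stands for p + i q in the complexification of V; the
    condition says that A (p + i q) = i nu (p + i q). *)
Definition weight_pair (R : pzRingType) (V : lmodType R) (A : V -> V) (nu : R)
    (u : V * V) :=
  A u.1 = - nu *: u.2 /\ A u.2 = nu *: u.1.

Section SkewEndo.
Variables (R : rcfType) (V : vectType R) (m : {dot V for idfun}) (A : 'End(V)).
Hypothesis A_skew : forall x y, m (A x) y = - m x (A y).
Import passmx.
Local Notation d := (\dim {:V}).
Local Notation toC := (real_complex R).

(** The spectral theorem in real terms: the real and imaginary parts of complex
    eigenvectors span V, and every weight occurs in the list nu. *)
Lemma skew_spectral : exists (nu : 'I_d -> R) (u : 'I_d -> V * V),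
  [/\ forall j, weight_pair A (nu j) (u j) /\ u j != (0, 0),
      forall U : {vspace V}, (forall j, (u j).1 \in U /\ (u j).2 \in U) ->
        forall v, v \in U &
      forall mu v, weight_pair A mu v -> v != (0, 0) -> exists j, mu = nu j].
Proof.
have [e [eB eo ec]] := orthonormal_basis m.
pose M := mxof e e A.
have Msk : M^T = - M.
  by apply/matrixP => i j; rewrite !mxE /= !vecof_delta !ec A_skew dotC.
have [W [nu [Wu WM]]] := skew_mx_spectral Msk.
pose P := map_mx (@complex.Re R) W; pose Q := map_mx (@complex.Im R) W.
have WE j l : (W *m map_mx toC M) j l = Complex 0 (nu j) * W j l.
  by rewrite WM mul_diag_mx !mxE.
have PM : P *m M = - diag_mx (\row_j nu j) *m Q.
  apply/matrixP => j l; rewrite mulNmx mul_diag_mx !mxE.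
  have := congr1 (@complex.Re R) (WE j l); rewrite mxE Re_sum.
  under eq_bigr => k _ do rewrite [X in _ * X]mxE Re_mulr.
  case: (W j l) => a b /= E.
  transitivity (0 * a - nu j * b); last by rewrite mul0r sub0r.
  by rewrite -E; apply: eq_bigr => k _; rewrite !mxE.
have QM : Q *m M = diag_mx (\row_j nu j) *m P.
  apply/matrixP => j l; rewrite mul_diag_mx !mxE.
  have := congr1 (@complex.Im R) (WE j l); rewrite mxE Im_sum.
  under eq_bigr => k _ do rewrite [X in _ * X]mxE Im_mulr.
  case: (W j l) => a b /=; rewrite mul0r add0r => E; rewrite -E.
  by apply: eq_bigr => k _; rewrite !mxE.
exists nu, (fun j => (vecof e (row j P), vecof e (row j Q))); split.
- move=> j; split; last first.
    apply/eqP => -[/eqP + /eqP]; rewrite !(vecof_eq0 eB) => /eqP p0 /eqP q0.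
    have W0 : row j W = 0.
      apply/rowP => l; apply/eqP; rewrite eq_complex.
      have := congr1 (fun B : 'rV_d => B 0 l) p0; have := congr1 (fun B : 'rV_d => B 0 l) q0.
      by rewrite !mxE => -> ->; rewrite !eqxx.
    have := congr1 (fun B : 'rV_d => B *m invmx W) W0.
    rewrite -row_mul mulmxV // mul0mx => /(congr1 (fun B : 'rV_d => B 0 j)) /eqP.
    by rewrite !mxE eqxx oner_eq0.
  split=> /=; rewrite (hom_vecof _ eB) -row_mul ?PM ?QM -linearZ /=; congr vecof.
    by apply/rowP => l; rewrite mulNmx mul_diag_mx !mxE mulNr.
  by apply/rowP => l; rewrite mul_diag_mx !mxE.
- move=> U UU v.
  rewrite -[v](rVofK eB).
  pose c := map_mx toC (rVof e v) *m invmx W.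
  have -> : rVof e v = \sum_j (complex.Re (c 0 j) *: row j P - complex.Im (c 0 j) *: row j Q).
    apply/rowP => l.
    have := congr1 (fun B : 'rV_d => complex.Re (B 0 l)) (mulmxKV Wu (map_mx toC (rVof e v))).
    rewrite -/c [in X in _ = X]mxE mxE Re_sum summxE /= => <-.
    apply: eq_bigr => k _; rewrite !mxE.
    by move: (\sum_j _) (W k l) => [a b] [a1 b1].
  rewrite linear_sum; apply: rpred_sum => j _; rewrite linearB !linearZ /=.
  by have [? ?] := UU j; apply: rpredD; apply: rpredZ; rewrite ?memvN.
- move=> mu [p q] [/= Ap Aq] pq0.
  (* a new weight vector is an eigenvector of A, so in the eigenbasis one of its
     coordinates is nonzero *)
  pose w : 'rV[R[i]]_d := \row_j Complex (rVof e p 0 j) (rVof e q 0 j).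
  have rM v : rVof e v *m M = rVof e (A v) by rewrite mul_mxof (rVofK eB).
  have wM : w *m map_mx toC M = Complex 0 mu *: w.
    apply/rowP => l; rewrite [RHS]mxE mxE.
    have p' : (rVof e p *m M) 0 l = - mu * rVof e q 0 l by rewrite rM Ap linearZ /= mxE.
    have q' : (rVof e q *m M) 0 l = mu * rVof e p 0 l by rewrite rM Aq linearZ /= mxE.
    rewrite [LHS]mxE in p'; rewrite [LHS]mxE in q'.
    rewrite [X in _ * X]mxE; apply/eqP; rewrite eq_complex Re_sum Im_sum.
    under eq_bigr => k _ do rewrite [X in _ * X]mxE Re_mulr.
    under [X in _ && (X == _)]eq_bigr => k _ do rewrite [X in _ * X]mxE Im_mulr.
    rewrite /= !mul0r sub0r add0r; apply/andP; split; apply/eqP.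
    + rewrite -mulNr; rewrite -p'; by apply: eq_bigr => k _; rewrite !mxE.
    + rewrite -q'; by apply: eq_bigr => k _; rewrite !mxE.
  pose c := w *m invmx W.
  have cD : c *m diag_mx (\row_j Complex 0 (nu j)) = Complex 0 mu *: c.
    have -> : diag_mx (\row_j Complex 0 (nu j)) = W *m map_mx toC M *m invmx W.
      by rewrite WM mulmxK.
    by rewrite !mulmxA mulmxKV // wM -scalemxAl.
  have c0 : c != 0.
    apply: contraNneq pq0 => c0.
    have w0 : w = 0 by rewrite -(mulmxKV Wu w) -/c c0 mul0mx.
    rewrite xpair_eqE -!(rVof_eq0 eB); apply/andP; split; apply/eqP/rowP => l;
      by have := congr1 (fun B : 'rV_d => B 0 l) w0; rewrite [X in X = _ -> _]mxE => /eqP;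
         rewrite eq_complex mxE => /andP[/eqP + /eqP]; rewrite !mxE.
  clearbody c; have [j cj] : exists j, c 0 j != 0 by apply/rV0Pn.
  exists j; have := congr1 (fun B : 'rV_d => B 0 j) cD.
  by rewrite mul_mx_diag !mxE mulrC => /(mulIf cj) [->].
Qed.
End SkewEndo.

(** * The centralizer of the Reeb vector *)

Section LieBasics.
Variables (F : fieldType) (g : lieAlgType F).
Implicit Types x y z : g.

Lemma lieDl x y z : lie (x + y) z = lie x z + lie y z.
Proof. by have := lie_linearl z 1 x y; rewrite !scale1r. Qed.
Lemma lieDr x y z : lie x (y + z) = lie x y + lie x z.
Proof. by have := lie_linearr x 1 y z; rewrite !scale1r. Qed.
Lemma lieC x y : lie x y = - lie y x.
Proof.
apply/eqP; rewrite -addr_eq0; apply/eqP.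
by have := liexx (x + y); rewrite lieDl !lieDr !liexx add0r addr0.
Qed.
Lemma lie0l x : lie 0 x = 0.
Proof. by apply: (addIr (lie 0 x)); rewrite -lieDl !add0r. Qed.
Lemma lie0r x : lie x 0 = 0.
Proof. by rewrite lieC lie0l oppr0. Qed.
Lemma lieZl a x y : lie (a *: x) y = a *: lie x y.
Proof. by have := lie_linearl y a x 0; rewrite !addr0 lie0l addr0. Qed.
Lemma lieZr a x y : lie x (a *: y) = a *: lie x y.
Proof. by rewrite lieC lieZl -scalerN -lieC. Qed.
Lemma lieNl x y : lie (- x) y = - lie x y.
Proof. by rewrite -scaleN1r lieZl scaleN1r. Qed.
Lemma lieNr x y : lie x (- y) = - lie x y.
Proof. by rewrite -scaleN1r lieZr scaleN1r. Qed.
Lemma lie_deriv x y z : lie x (lie y z) = lie (lie x y) z + lie y (lie x z).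
Proof.
have := lie_jacobi x y z => /eqP.
rewrite (lieC z (lie x y)) (lieC z x) lieNr -addrA addr_eq0 opprD !opprK addrC => /eqP ->.
by [].
Qed.
End LieBasics.

Section Ad.
Variables (F : fieldType) (g : finDimLieAlgType F).
Implicit Types x y z : g.
HB.instance Definition _ x := GRing.isLinear.Build F g g *:%R (lie x) (lie_linearr x).

Lemma adE x y : ad x y = lie x y.
Proof. by rewrite /ad lfunE. Qed.
Lemma ad_linear : linear (@ad _ g).
Proof.
by move=> a x y; apply/lfunP => z; rewrite !lfunE /= !adE !lfunE /= lieDl lieZl adE.
Qed.
End Ad.

Lemma scalarD (F : fieldType) (V : lmodType F) (f : V -> F) : scalar f ->
  forall x y, f (x + y) = f x + f y.
Proof. by move=> fs x y; have := fs 1 x y; rewrite scale1r mul1r. Qed.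

Section TraceFunctional.
Variables (F : fieldType) (g : finDimLieAlgType F).
(** For f = ad xi this is the Killing form against xi. *)
Definition trace_ad (f : 'End(g)) (x : g) : F := endo_trace (f \o ad x)%VF.

Lemma trace_ad_scalar f : scalar (trace_ad f).
Proof.
move=> a x y; rewrite /trace_ad ad_linear.
by rewrite comp_lfunDr -comp_lfunZr endo_traceD endo_traceZ.
Qed.

Lemma trace_ad_lie f z y : (f \o ad z)%VF = (ad z \o f)%VF -> trace_ad f (lie z y) = 0.
Proof.
move=> fz; rewrite /trace_ad.
have -> : ad (lie z y) = (ad z \o ad y)%VF - (ad y \o ad z)%VF.
  by apply/lfunP => w; rewrite add_lfunE opp_lfunE !comp_lfunE !adE lie_deriv addrK.
rewrite comp_lfunDr comp_lfunNr endo_traceD -scaleN1r endo_traceZ mulN1r.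
rewrite !comp_lfunA fz -(comp_lfunA (ad z)) endo_trace_mulC subrr //.
Qed.
End TraceFunctional.

Section Reeb.
Variables (R : rcfType) (g : finDimLieAlgType R).
Variables (eta : {scalar g}) (xi : g) (m : {dot g for idfun}) (Phi : 'End(g)).
Hypothesis unimod : unimodular g.
Hypothesis centerless : trivial_center g.
Hypothesis contact : metric_contact eta xi m Phi.
Hypothesis Kc : forall x y, m (ad xi x) y = - m x (ad xi y).
Local Notation A := (ad xi).
Local Notation s := (trace_ad A).

Lemma eta_xi : eta xi = 1. Proof. by have [_ []] := contact. Qed.
Lemma eta_lie_xi y : eta (lie xi y) = 0.
Proof. by have [_ [_ /(_ y)/eqP]] := contact; rewrite /dform oppr_eq0 => /eqP. Qed.
Lemma xi_neq0 : xi != 0.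
Proof. by apply: contra_eq_neq eta_xi => ->; rewrite linear0 eq_sym oner_neq0. Qed.
Lemma ad_xi_neq0 : A != 0.
Proof.
apply: contraNneq xi_neq0 => A0; apply/eqP/centerless => y.
by rewrite -adE A0 lfunE.
Qed.
Lemma eta_lie x y : eta (lie x y) = - (2 * m x (Phi y)).
Proof. by have [_ _ _ <- _] := contact; rewrite opprK. Qed.
Lemma Phi_sqr x : Phi (Phi x) = - x + eta x *: xi.
Proof. by have [] := contact. Qed.
Lemma eta_dot x : eta x = m xi x.
Proof. by have [] := contact. Qed.

Lemma Phi_skew x y : m x (Phi y) = - m y (Phi x).
Proof.
have := eta_lie x y; rewrite lieC linearN /= eta_lie; lra.
Qed.

(** The compatibility of Phi with the metric makes d eta nondegenerate modulo
    xi. *)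
Lemma dform_kernel x : (forall y, eta (lie x y) = 0) -> x = eta x *: xi.
Proof.
move=> h; have Phi0 : Phi x = 0.
  apply/eqP; rewrite -(dot_eq0 m); apply/eqP.
  have := h (Phi x); rewrite eta_lie Phi_skew; have := Phi_skew x (Phi x); lra.
by have := Phi_sqr x; rewrite Phi0 linear0 addrC => /eqP; rewrite eq_sym subr_eq0 => /eqP.
Qed.

Lemma trace_ad_xi_neq0 : s xi != 0.
Proof.
rewrite lt_eqF // /trace_ad /endo_trace.
exact: (skew_sqr_trace Kc (vbasisP _) ad_xi_neq0).
Qed.

(** The Jacobi identity says that ad z commutes with ad xi, and the trace of
    f o [ad z, ad y] is zero when f commutes with ad z. *)
Lemma trace_ad_centralizer z y : lie xi z = 0 -> s (lie z y) = 0.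
Proof.
move=> xz; apply: trace_ad_lie; apply/lfunP => w.
by rewrite !comp_lfunE !adE lie_deriv xz lie0l add0r.
Qed.

Definition sigma x := s x / s xi.

(** The forms b and c below are such that b + t c is
    (eta + t (sigma - eta)) [x, y] + s x * s y.  The added square makes up for
    the kernel xi, so that b is nondegenerate; so is then b + c, while any x in
    the centralizer with s x = 0 lies in the kernel of b + c. *)
Lemma centralizer_xi x : lie xi x = 0 -> exists a, x = a *: xi.
Proof.
pose del x := sigma x - eta x.
pose b x y := eta (lie x y) + s x * s y.
pose c x y := del (lie x y).
have ss := trace_ad_scalar A.
have ds : scalar del by move=> a u v; rewrite /del /sigma ss linearP /=; ring.
have bb : bilinear_form b.
  by split=> [y|x'] a u v; rewrite /b ?lieDl ?lieDr ?lieZl ?lieZr ss linearP /=; ring.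
have cb : bilinear_form c.
  by split=> [y|x'] a u v; rewrite /c ?lieDl ?lieDr ?lieZl ?lieZr ds.
have s0 := trace_ad_xi_neq0.
have sxi y : s (lie xi y) = 0 by apply: trace_ad_centralizer; rewrite liexx.
have dxi : del xi = 0 by rewrite /del /sigma divff // eta_xi subrr.
have dlie y : del (lie xi y) = 0 by rewrite /del /sigma sxi eta_lie_xi mul0r subrr.
have dlie' y : del (lie y xi) = 0.
  by rewrite lieC -scaleN1r -[_ *: _]addr0 ds dlie; have := ds 1 0 0; rewrite scaler0 addr0; lra.
have nb : left_nondegenerate b.
  move=> y yb; have : b y xi = 0 by [].
  rewrite /b lieC linearN /= eta_lie_xi oppr0 add0r => /eqP.
  rewrite mulf_eq0 (negPf s0) orbF => /eqP sy.
  have yE : y = eta y *: xi.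
    by apply: dform_kernel => z; have := yb z; rewrite /b sy mul0r addr0.
  have : s (eta y *: xi + 0) = 0 by rewrite addr0 -yE.
  rewrite ss; have -> : s 0 = 0 by have := ss 1 0 0; rewrite scaler0 addr0; lra.
  by rewrite addr0 => /eqP; rewrite mulf_eq0 (negPf s0) orbF => /eqP e0; rewrite yE e0 scale0r.
have nbc : left_nondegenerate (fun x y => b x y + c x y).
  apply: nondegenerate_deform => //= t nbt.
  have btb : bilinear_form (fun x y => b x y + t * c x y).
    have [[bl br] [cl cr]] := (bb, cb).
    by split=> [y|x'] a u v /=; rewrite ?bl ?br ?cl ?cr !mulrDr; ring.
  (* del is tangent to the coadjoint orbit: it is the contraction of the form
     with some z, which commutes with xi because xi fixes all the data *)
  have [z zE] := nondegenerate_dual btb nbt ds.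
  have sz : s z = 0.
    have := zE xi; rewrite dxi /b /c dlie' lieC linearN /= eta_lie_xi oppr0 add0r mulr0 addr0.
    by move=> /eqP; rewrite mulf_eq0 (negPf s0) orbF => /eqP.
  have zx : lie xi z = 0.
    apply: nbt => y.
    have lz l : scalar l -> (forall w, l (lie xi w) = 0) ->
        l (lie (lie xi z) y) = - l (lie z (lie xi y)).
      move=> ls l0; have := l0 (lie z y); rewrite lie_deriv.
      by rewrite (scalarD ls) => /eqP; rewrite addr_eq0 => /eqP.
    have := zE (lie xi y); rewrite dlie /b /c sz mul0r addr0 sxi mul0r addr0.
    rewrite (lz del) //; have -> := lz eta; last exact: eta_lie_xi.
      lra.
    by move=> a u v; rewrite linearP.
  exists (ad z) => [|x' y]; first exact: unimod.
  rewrite !adE /b /c -[in LHS]zE /b /c sz mul0r addr0.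
  rewrite !(trace_ad_centralizer _ zx) mul0r mulr0 !addr0 lie_deriv linearD /=.
  by rewrite (scalarD ds); ring.
move=> xx.
suff x0 : x - sigma x *: xi = 0.
  by exists (sigma x); apply/eqP; rewrite -subr_eq0 x0.
apply: nbc => y; set w := x - _.
have wx : lie xi w = 0 by rewrite /w lieDr lieNr lieZr liexx xx scaler0 subr0.
have sw : s w = 0.
  by rewrite /w addrC -scaleNr ss /sigma mulNr divfK // addNr.
rewrite /b /c /del sw mul0r addr0 /sigma (trace_ad_centralizer _ wx) mul0r.
by rewrite sub0r subrr.
Qed.
End Reeb.

(** * Weights in the complexification *)

(** Testing against functionals turns identities between vectors into identities
    of a commutative ring. *)
Lemma scalar_ext (F : fieldType) (V : vectType F) (u v : V) :
  (forall f : {scalar V}, f u = f v) -> u = v.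
Proof.
move=> uv; rewrite (coord_vbasis (memvf u)) (coord_vbasis (memvf v)).
by apply: eq_bigr => i _; rewrite (uv (coord (vbasis fullv) i)).
Qed.

Section Complexification.
Variables (R : realFieldType) (g : finDimLieAlgType R).
Implicit Types u v w : g * g.

(** The pair u stands for u.1 + i u.2; this is the complex bilinear extension of
    the bracket. *)
Definition clie u v : g * g :=
  (lie u.1 v.1 - lie u.2 v.2, lie u.1 v.2 + lie u.2 v.1).
Definition cconj u : g * g := (u.1, - u.2).

Lemma clie_deriv u v w : clie u (clie v w) = clie (clie u v) w + clie v (clie u w).
Proof.
case: u v w => [u1 u2] [v1 v2] [w1 w2]; rewrite /clie /=.
congr pair; rewrite /= !(lieDl, lieDr, lieNl, lieNr);
  rewrite (lie_deriv u1 v1) (lie_deriv u1 v2) (lie_deriv u2 v1) (lie_deriv u2 v2);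
  by apply: scalar_ext => f; rewrite !(linearD, linearN) /=; ring.
Qed.

Lemma clieZr a u v : clie u (a *: v) = a *: clie u v.
Proof.
congr pair; rewrite /= !lieZr ?scalerBr ?scalerDr; reflexivity.
Qed.
Lemma clieDr u v w : clie u (v + w) = clie u v + clie u w.
Proof.
by congr pair; rewrite /= !lieDr; apply: scalar_ext => f; rewrite !(linearD, linearN) /=; ring.
Qed.
Lemma clie0r u : clie u 0 = 0.
Proof. by have := clieZr 0 u 0; rewrite !scale0r. Qed.

Variable xi : g.
Local Notation wt := (weight_pair (lie xi)).

Lemma weight_clie nu mu u v : wt nu u -> wt mu v -> wt (nu + mu) (clie u v).
Proof.
case: u v => [u1 u2] [v1 v2] [/= a b] [/= c d]; split; rewrite /= !(lieDr, lieNr);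
  rewrite ?(lie_deriv xi u1 v1) ?(lie_deriv xi u1 v2) ?(lie_deriv xi u2 v1) ?(lie_deriv xi u2 v2);
  rewrite a b c d !(lieZl, lieZr);
  by apply: scalar_ext => f; rewrite !(linearD, linearN, linearZ) /=;
    rewrite ?linearN ?linearD /=; ring.
Qed.

Lemma weight_conj nu u : wt nu u -> wt (- nu) (cconj u).
Proof. by case=> a b; split; rewrite /= ?lieNr ?a ?b ?opprK ?scaleNr ?scalerN ?opprK. Qed.

Lemma weightZ nu a u : wt nu u -> wt nu (a *: u).
Proof. by case=> h k; split; rewrite /= lieZr ?h ?k !scalerA mulrC. Qed.
Lemma weightD nu u v : wt nu u -> wt nu v -> wt nu (u + v).
Proof. by case=> h k [h' k']; split; rewrite /= lieDr ?h ?k ?h' ?k' scalerDr. Qed.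

(** This is multiplication by i. *)
Lemma weight_rot nu u : wt nu u -> wt nu (- u.2, u.1).
Proof. by case=> h k; split; rewrite /= ?lieNr ?h ?k ?scalerN ?scaleNr. Qed.
Lemma weight_swap nu u : wt nu u -> wt (- nu) (u.2, u.1).
Proof. by case=> h k; split; rewrite /= ?h ?k ?opprK. Qed.

Section Ladder.
Variables (e : g * g) (lam c : R).
Hypotheses (e_wt : wt lam e) (e_br : lie e.1 e.2 = c *: xi).
Local Notation E := (clie e).
Local Notation F := (clie (cconj e)).

(** The bracket of e = x + i y with its conjugate is - 2 i [x, y] = - 2 i c xi,
    which acts on the weight space of nu as 2 c nu. *)
Lemma ladder_comm nu v : wt nu v -> E (F v) = (2 * c * nu) *: v + F (E v).
Proof.
move=> [v1 v2]; rewrite clie_deriv; congr (_ + _).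
have -> : clie e (cconj e) = (0, (- 2 * c) *: xi).
  rewrite /clie /= !lieNr !liexx e_br (lieC e.2) e_br; congr pair.
    by rewrite !oppr0 addr0.
  by apply: scalar_ext => f; rewrite !(linearD, linearN, linearZ) /=; ring.
congr pair; rewrite /= lie0l lieZl ?v1 ?v2 scalerA ?sub0r ?add0r -?scaleNr;
  congr (_ *: _); ring.
Qed.

(** Each step of the string adds 2 c times its weight; the coefficient is the sum
    of 2 c (nu - k lam) over k <= j. *)
Lemma ladder_string nu v j : wt nu v -> E v = 0 ->
  wt (nu - j%:R * lam) (iter j F v) /\
  E (F (iter j F v)) = (2 * c * (j.+1%:R * (nu - j%:R * lam / 2))) *: iter j F v.
Proof.
move=> v_wt Ev; elim: j => [|j [IH1 IH2]] /=.
  rewrite mul0r subr0; split=> //.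
  by rewrite (ladder_comm v_wt) Ev clie0r addr0 !mul0r subr0 mul1r.
have w1 : wt (nu - j.+1%:R * lam) (F (iter j F v)).
  have -> : nu - j.+1%:R * lam = - lam + (nu - j%:R * lam) by rewrite -natr1; ring.
  by apply: weight_clie => //; apply: weight_conj.
split=> //; rewrite (ladder_comm w1) IH2 clieZr -scalerDl; congr (_ *: _).
by rewrite -!natr1; field.
Qed.

(** At the last nonzero vector of the string the coefficient of the ladder
    relation has to vanish. *)
Lemma highest_weight nu v k : c != 0 -> wt nu v -> v != 0 -> E v = 0 ->
  iter k F v = 0 -> exists2 j, (j < k)%N & nu = j%:R * lam / 2.
Proof.
move=> c0 v_wt v0 Ev; elim: k => [/= h|k IH /= Fk]; first by rewrite h eqxx in v0.
have [z|nz] := eqVneq (iter k F v) 0.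
  by have [j jk ->] := IH z; exists j => //; apply: ltnW.
exists k => //; have [_] := ladder_string k v_wt Ev; rewrite Fk clie0r => /esym/eqP.
rewrite scaler_eq0 (negPf nz) orbF !mulf_eq0 pnatr_eq0 (negPf c0) pnatr_eq0 /=.
by rewrite subr_eq0 => /eqP.
Qed.

End Ladder.

Hypothesis cent : forall x, lie xi x = 0 -> exists a, x = a *: xi.

Lemma weight0E u : wt 0 u -> exists a b, u = (a *: xi, b *: xi).
Proof.
case: u => [u1 u2] [/= h k]; rewrite oppr0 !scale0r in h k.
by have [[a ->] [b ->]] := (cent h, cent k); exists a, b.
Qed.

(** A zero weight vector is a complex multiple of xi; bracketing with u gives a
    multiple of u. *)
Lemma clie2_weight0 mu u v : wt mu u -> wt 0 v -> clie u (clie u v) = 0.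
Proof.
move=> [h k] /weight0E [a [b ->]].
have l1 : lie u.1 xi = mu *: u.2 by rewrite lieC h scaleNr opprK.
have l2 : lie u.2 xi = - mu *: u.1 by rewrite lieC k scaleNr.
by congr pair; rewrite /= !lieZr l1 l2 !(lieDr, lieNr, lieZr) !liexx (lieC u.2 u.1);
  apply: scalar_ext => f; rewrite !(linearD, linearN, linearZ, linear0) /=; ring.
Qed.

Variables (lam c : R) (e : g * g).
Hypotheses (lam_gt0 : 0 < lam) (c_neq0 : c != 0) (e_wt : wt lam e)
  (e_br : lie e.1 e.2 = c *: xi).
Hypothesis lam_max : forall nu v, wt nu v -> v != 0 -> `|nu| <= lam.
Hypothesis triple : forall nu v, nu != 0 -> wt nu v -> v != 0 ->
  exists e' c', [/\ wt nu e', lie e'.1 e'.2 = c' *: xi & c' != 0].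

Lemma e_neq0 : xi != 0 -> e != 0.
Proof.
move=> x0; apply: contraNneq c_neq0 => e0; move: e_br; rewrite e0 lie0l => /esym/eqP.
by rewrite scaler_eq0 (negPf x0) orbF.
Qed.

Lemma weight_gt nu v : wt nu v -> lam < `|nu| -> v = 0.
Proof.
move=> h l; apply/eqP; apply: contraT => v0; have := lam_max h v0.
by rewrite leNgt l.
Qed.

(** Lowered by conj e, v dies after three steps for lack of weights, leaving
    nu = lam / 2 or nu = lam.  In the first case the string of e under the
    triple of weight lam / 2 reaches weight 0 after two steps and is killed two
    steps later, whereas a highest weight equal to four half-roots demands a
    string of length five. *)
Lemma weight_pos_eq nu v : xi != 0 -> 0 < nu -> wt nu v -> v != 0 -> nu = lam.
Proof.
move=> x0 nu0 vw v0.
have nul : nu <= lam by have := lam_max vw v0; rewrite gtr0_norm.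
have Ev : clie e v = 0 by apply: weight_gt (weight_clie e_wt vw) _; rewrite gtr0_norm; lra.
have F3 : iter 3 (clie (cconj e)) v = 0.
  have [h _] := ladder_string e_wt e_br 3 vw Ev.
  by apply: weight_gt h _; rewrite ltr0_norm; lra.
have [[|[|[|//]]] _ nuE] := highest_weight e_wt e_br c_neq0 vw v0 Ev F3; [lra| |lra].
have nuE' : nu = lam / 2 by lra.
have [e' [c' [e'w e'b c'0]]] := triple (lt0r_neq0 nu0) vw v0.
have Ee : clie e' e = 0 by apply: weight_gt (weight_clie e'w e_wt) _; rewrite gtr0_norm; lra.
have F4 : iter 4 (clie (cconj e')) e = 0.
  have [h _] := ladder_string e'w e'b 2 e_wt Ee.
  rewrite !iterS; apply: clie2_weight0 (weight_conj e'w) _.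
  by move: h; rewrite nuE'; have -> : lam - 2 * (lam / 2) = 0 by lra.
by have [[|[|[|[|//]]]] _ lE] := highest_weight e'w e'b c'0 e_wt (e_neq0 x0) Ee F4; lra.
Qed.

(** Applying conj e to v lands on a complex multiple of xi, which is also
    obtained from a complex multiple of e; the difference is killed by e and by
    conj e, so it is zero since its weight is not. *)
Lemma weight_max_span v : wt lam v -> exists a b, v = a *: e + b *: (- e.2, e.1).
Proof.
move=> vw.
have Fw : wt 0 (clie (cconj e) v).
  by have := weight_clie (weight_conj e_wt) vw; rewrite addNr.
have [a [b Fv]] := weight0E Fw.
pose w := v + (- (b / (2 * c)) *: e + (a / (2 * c)) *: (- e.2, e.1)).
have ww : wt lam w by do ![apply: weightD|apply: weightZ|apply: weight_rot] => //.
have Ew : clie e w = 0.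
  by apply: weight_gt (weight_clie e_wt ww) _; rewrite gtr0_norm ?addr_gt0 // ltrDl.
have c2 : 2 * c != 0 by rewrite mulf_neq0 // pnatr_eq0.
have Fw0 : iter 1 (clie (cconj e)) w = 0.
  rewrite /= !clieDr !clieZr Fv; congr pair; rewrite /= !(lieNl, lieNr) !liexx (lieC e.2) e_br;
   by apply: scalar_ext => f; rewrite !(linearD, linearN, linearZ, linear0) /=; field.
have w0 : w = 0.
  apply/eqP; apply: contraT => wn.
  have [j] := highest_weight e_wt e_br c_neq0 ww wn Ew Fw0.
  by rewrite ltnS leqn0 => /eqP -> lE; move: lam_gt0; rewrite lE !mul0r ltxx.
exists (b / (2 * c)), (- (a / (2 * c))).
move/eqP: w0; rewrite addr_eq0 => /eqP ->.
by rewrite opprD scaleNr opprK scaleNr.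
Qed.

Lemma weight_span nu v : xi != 0 -> wt nu v ->
  v.1 \in <<[:: xi; e.1; e.2]>>%VS /\ v.2 \in <<[:: xi; e.1; e.2]>>%VS.
Proof.
move=> x0; wlog nu0 : nu v / 0 <= nu => [H vw|vw].
  have [/H|] := leP 0 nu; first exact.
  by rewrite -oppr_gt0 => /ltW /H /(_ (weight_swap vw)) [].
have mX : xi \in <<[:: xi; e.1; e.2]>>%VS by rewrite memv_span // !inE eqxx.
have m1 : e.1 \in <<[:: xi; e.1; e.2]>>%VS by rewrite memv_span // !inE eqxx orbT.
have m2 : e.2 \in <<[:: xi; e.1; e.2]>>%VS by rewrite memv_span // !inE eqxx !orbT.
have [->|v0] := eqVneq v 0; first by rewrite !mem0v.
have [nuz|nuz] := eqVneq nu 0.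
  by rewrite nuz in vw; have [a [b ->]] := weight0E vw; rewrite !memvZ.
have nuE : nu = lam by apply: weight_pos_eq vw v0 => //; rewrite lt_def nuz.
rewrite nuE in vw; have [a [b ->]] := weight_max_span vw.
by rewrite /= !rpredD ?rpredZ ?rpredN.
Qed.

End Complexification.

(** * The algebras sl(2, R) and su(2) *)

Section Standard.
Variables (F : fieldType) (h : lieAlgType F).
Implicit Types u x y : h.

(** Up to scaling, eps = 1 gives sl(2, R) and eps = -1 gives su(2); here u
    generates a rotation of the plane of x and y. *)
Definition rot_triple (eps : F) u x y :=
  [/\ lie u x = - y, lie u y = x & lie x y = eps *: u].

Definition comb3 (a : F * F * F) u x y : h := a.1.1 *: u + a.1.2 *: x + a.2 *: y.

Definition bracket3 (eps : F) (a b : F * F * F) : F * F * F :=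
  (eps * (a.1.2 * b.2 - a.2 * b.1.2), a.1.1 * b.2 - a.2 * b.1.1, a.1.2 * b.1.1 - a.1.1 * b.1.2).

Lemma lie_comb3 eps u x y a b : rot_triple eps u x y ->
  lie (comb3 a u x y) (comb3 b u x y) = comb3 (bracket3 eps a b) u x y.
Proof.
case: a b => [[a1 a2] a3] [[b1 b2] b3] [ux uy xy]; rewrite /comb3 /=.
rewrite !(lieDl, lieDr) !(lieZl, lieZr) !liexx (lieC x u) (lieC y u) (lieC y x) ux uy xy.
rewrite !scaler0 add0r addr0 opprK !scalerN !scalerA !scalerBl.
rewrite addr0 mulrBr scalerBl [eps * (a2 * _)]mulrC [eps * (a3 * _)]mulrC.
by rewrite [LHS](AC (2*2*2) ((4*6)*(2*5)*(3*1))).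
Qed.
End Standard.

Lemma lie_isomorphic_rot_triple (F : fieldType) (g : finDimLieAlgType F) (h : lieAlgType F)
   (eps : F) (u x y : g) (u' x' y' : h) :
  rot_triple eps u x y -> basis_of {:g} [:: u; x; y] ->
  rot_triple eps u' x' y' ->
  (forall w, exists a, w = comb3 a u' x' y') ->
  (forall a, comb3 a u' x' y' = 0 -> a = (0, 0, 0)) ->
  lie_isomorphic g h.
Proof.
move=> rg gB rh hs hi.
pose X := [tuple u; x; y].
pose i1 : 'I_3 := lift ord0 ord0; pose i2 : 'I_3 := lift ord0 (lift ord0 ord0).
pose co v := (coord X ord0 v, coord X i1 v, coord X i2 v).
have vE v : v = comb3 (co v) u x y.
  rewrite {1}(coord_basis (gB : basis_of {:g} X) (memvf v)).
  by rewrite !big_ord_recl big_ord0 addr0 addrA.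
pose f v := comb3 (co v) u' x' y'.
have fl : linear f.
  move=> a v w; rewrite /f /comb3 /= !linearP /= !scalerDr !scalerDl !scalerA.
  by rewrite [LHS](AC (2*2*2) ((1*3*5)*(2*4*6))).
have coK a : co (comb3 a u x y) = a.
  have fr := basis_free gB.
  case: a => [[a b] c]; rewrite /co /comb3 /= !linearD !linearZ /=.
  have E (i j : 'I_3) : coord X i X`_j = (i == j)%:R.
    by rewrite (coord_free _ _ (fr : free X)) eq_sym.
  have Eu i : coord X i u = (i == ord0)%:R := E i ord0.
  have Ex i : coord X i x = (i == i1)%:R := E i i1.
  have Ey i : coord X i y = (i == i2)%:R := E i i2.
  by rewrite !Eu !Ex !Ey -!val_eqE /= !(mulr0, mulr1, addr0, add0r).
have fbr v w : f (lie v w) = lie (f v) (f w).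
  by rewrite /f (lie_comb3 _ _ rh) {1}(vE v) {1}(vE w) (lie_comb3 _ _ rg) coK.
have finj : injective f.
  move=> v w fvw; apply/eqP; rewrite -subr_eq0; apply/eqP.
  have : f (v - w) = 0 by rewrite addrC -scaleN1r fl fvw scaleN1r addNr.
  by move=> /hi c0; rewrite (vE (v - w)) c0 /comb3 !scale0r !addr0.
have fsurj w : exists v, f v == w.
  by have [a ->] := hs w; exists (comb3 a u x y); rewrite /f coK.
exists (HB.pack_for {linear g -> h} f (GRing.isLinear.Build F g h *:%R f fl)); split=> //.
exists (fun w => xchoose (fsurj w)) => v /=.
  by apply: finj; apply/eqP/(xchooseP (fsurj (f v))).
by apply/eqP/(xchooseP (fsurj v)).
Qed.

Section TwoByTwo.
Variable K : comNzRingType.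
Definition mx22 (a b c d : K) : 'M[K]_2 :=
  \matrix_(i, j) if i == 0 then (if j == 0 then a else b) else (if j == 0 then c else d).

Lemma mx22P (A B : 'M[K]_2) :
  A 0 0 = B 0 0 -> A 0 1 = B 0 1 -> A 1 0 = B 1 0 -> A 1 1 = B 1 1 -> A = B.
Proof.
move=> h00 h01 h10 h11; apply/matrixP => i j.
have I2 (k : 'I_2) : k = 0 \/ k = 1.
  by case: k => [[|[|//]] hk]; [left|right]; apply: val_inj.
by case: (I2 i) => ->; case: (I2 j) => ->.
Qed.

Lemma mx22_eta (A : 'M[K]_2) : A = mx22 (A 0 0) (A 0 1) (A 1 0) (A 1 1).
Proof. by apply: mx22P; rewrite mxE. Qed.

Lemma mx22D a b c d a' b' c' d' :
  mx22 a b c d + mx22 a' b' c' d' = mx22 (a + a') (b + b') (c + c') (d + d').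
Proof. by apply: mx22P; rewrite !mxE. Qed.
Lemma mx22Z k a b c d : k *: mx22 a b c d = mx22 (k * a) (k * b) (k * c) (k * d).
Proof. by apply: mx22P; rewrite !mxE. Qed.
Lemma mx22N a b c d : - mx22 a b c d = mx22 (- a) (- b) (- c) (- d).
Proof. by apply: mx22P; rewrite !mxE. Qed.

Lemma mxcomm22 a b c d a' b' c' d' :
  mxcomm (mx22 a b c d) (mx22 a' b' c' d') =
  mx22 (b * c' - b' * c) (a * b' + b * d' - a' * b - b' * d)
       (c * a' + d * c' - c' * a - d' * c) (c * b' - c' * b).
Proof.
by apply: mx22P; rewrite /mxcomm !mxE !big_ord_recl !big_ord0 !mxE /=; ring.
Qed.

Lemma mxtrace22 a b c d : \tr (mx22 a b c d) = a + d.
Proof. by rewrite /mxtrace !big_ord_recl big_ord0 !mxE addr0. Qed.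
Lemma mxtrace2 (A : 'M[K]_2) : \tr A = A 0 0 + A 1 1.
Proof. by rewrite [A in LHS]mx22_eta mxtrace22. Qed.
End TwoByTwo.

Section SL2.
Variable R : realFieldType.
Fact mx22_sl (a b c : R) : mx22 a b c (- a) \in @sl_pred R 2.
Proof. by rewrite unfold_in mxtrace22 subrr. Qed.
Definition sl22 a b c : sl R 2 := Sl (mx22_sl a b c).

Lemma sl22_comb3 a : comb3 a (sl22 0 2^-1 (- 2^-1)) (sl22 2^-1 0 0) (sl22 0 2^-1 2^-1) =
  sl22 (a.1.2 / 2) ((a.1.1 + a.2) / 2) ((a.2 - a.1.1) / 2).
Proof.
apply: val_inj; rewrite /= !mx22Z !mx22D.
by congr mx22; field.
Qed.

(** Half of the generator of rotations and of two reflections of the plane. *)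
Lemma sl22_rot_triple :
  rot_triple 1 (sl22 0 2^-1 (- 2^-1)) (sl22 2^-1 0 0) (sl22 0 2^-1 2^-1).
Proof.
by split; apply: val_inj; rewrite /= mxcomm22 ?scale1r ?mx22N; congr mx22; field.
Qed.

Lemma lie_isomorphic_sl2 (g : finDimLieAlgType R) (u x y : g) :
  rot_triple 1 u x y -> basis_of {:g} [:: u; x; y] -> lie_isomorphic g (sl R 2).
Proof.
move=> rg gB; apply: (lie_isomorphic_rot_triple rg gB sl22_rot_triple).
- case=> w wP; have := wP; rewrite unfold_in mxtrace2 => /eqP tr0.
  exists (w 0 1 - w 1 0, 2 * w 0 0, w 0 1 + w 1 0); rewrite sl22_comb3; apply: val_inj => /=.
  rewrite [LHS]mx22_eta; congr mx22; lra.
- case=> [[a b] c]; rewrite sl22_comb3 => /(congr1 (@sl_val R 2)) /= E.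
  have e i j := congr1 (fun A : 'M_2 => A i j) E.
  have := e 0 0; have := e 0 1; have := e 1 0; rewrite !mxE /= => h1 h2 h3.
  by congr (_, _, _); lra.
Qed.
End SL2.

Section SU2.
Variable R : rcfType.
Local Open Scope complex_scope.
Lemma complex_eq (z w : R[i]) : z = w ->
  complex.Re z = complex.Re w /\ complex.Im z = complex.Im w.
Proof. by move->. Qed.
Fact mx22_su (a b c : R) : mx22 (0 +i* a) (b +i* c) (- b +i* c) (0 -i* a) \in @su_pred R 2.
Proof.
rewrite unfold_in mxtrace22; apply/andP; split; apply/eqP; last first.
  by apply/eqP; rewrite eq_complex /= addr0 subrr !eqxx.
by apply: mx22P; rewrite !mxE /=; apply/eqP; rewrite eq_complex /= ?oppr0 ?opprK !eqxx.
Qed.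
Definition su22 a b c : su R 2 := Su (mx22_su a b c).

Lemma su22_comb3 a : comb3 a (su22 0 2^-1 0) (su22 2^-1 0 0) (su22 0 0 2^-1) =
  su22 (a.1.2 / 2) (a.1.1 / 2) (a.2 / 2).
Proof.
apply: val_inj; rewrite /= !mx22Z !mx22D.
by congr mx22; apply/eqP; rewrite eq_complex /=; apply/andP; split; apply/eqP; field.
Qed.

(** The same matrices, the two symmetric ones multiplied by i: this makes them
    skew-hermitian and flips the sign of their bracket. *)
Lemma su22_rot_triple :
  rot_triple (-1) (su22 0 2^-1 0) (su22 2^-1 0 0) (su22 0 0 2^-1).
Proof.
by split; apply: val_inj; rewrite /= mxcomm22 ?mx22Z ?mx22N; congr mx22;
  apply/eqP; rewrite eq_complex /=; apply/andP; split; apply/eqP; field.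
Qed.

Lemma lie_isomorphic_su2 (g : finDimLieAlgType R) (u x y : g) :
  rot_triple (-1) u x y -> basis_of {:g} [:: u; x; y] -> lie_isomorphic g (su R 2).
Proof.
move=> rg gB; apply: (lie_isomorphic_rot_triple rg gB su22_rot_triple).
- case=> w wP; have := wP; rewrite unfold_in mxtrace2 => /andP[/eqP E /eqP tr0].
  exists (2 * complex.Re (w 0 1), 2 * complex.Im (w 0 0), 2 * complex.Im (w 0 1)).
  rewrite su22_comb3; apply: val_inj => /=.
  have e i j := congr1 (fun A : 'M_2 => A i j) E.
  have := e 0 0; have := e 0 1; have := e 1 0; move: tr0.
  rewrite [w in _ -> _ -> _ -> w = _]mx22_eta !mxE /=.
  case: (w 0 0) (w 0 1) (w 1 0) (w 1 1) => [a a'] [b b'] [c c'] [d d'] /=.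
  move=> /complex_eq[/= ad ad'] /complex_eq[/= bc bc'] _ /complex_eq[/= aa _].
  by congr mx22; congr Complex; lra.
- case=> [[a b] c]; rewrite su22_comb3 => /(congr1 (@su_val R 2)) /= E.
  have e i j := congr1 (fun A : 'M_2 => A i j) E.
  have := e 0 0; have := e 0 1; rewrite !mxE /= => /complex_eq[/= h1 h2] /complex_eq[/= _ h3].
  by congr (_, _, _); lra.
Qed.
End SU2.

(** * The classification *)

Lemma rot_triple_free (F : fieldType) (g : finDimLieAlgType F) eps (u x y : g) :
  rot_triple eps u x y -> eps != 0 -> u != 0 -> free [:: u; x; y].
Proof.
move=> [ux uy xy] e0 u0.
have yx : lie y x = - (eps *: u) by rewrite lieC xy.
have z a b c : a *: u + (b *: x + c *: y) = 0 -> [/\ a = 0, b = 0 & c = 0].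
  move=> h.
  have bc : b *: x + c *: y = 0.
    have := congr1 (fun w => - lie u (lie u w)) h.
    rewrite !(lieDr, lieZr) liexx !lie0r scaler0 add0r ux uy lieNr uy ux.
    by rewrite oppr0 opprD !scalerN !opprK => <-.
  rewrite bc addr0 in h.
  have a0 : a = 0 by apply/eqP; move/eqP: h; rewrite scaler_eq0 (negPf u0) orbF.
  have b0 : b = 0.
    have /eqP := congr1 (fun w => lie w y) bc.
    rewrite lieDl !lieZl liexx scaler0 addr0 xy lie0l scalerA scaler_eq0 (negPf u0) orbF.
    by rewrite mulf_eq0 (negPf e0) orbF => /eqP.
  have c0 : c = 0.
    have /eqP := congr1 (lie x) bc.
    rewrite lieDr !lieZr liexx scaler0 add0r xy lie0r scalerA scaler_eq0 (negPf u0) orbF.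
    by rewrite mulf_eq0 (negPf e0) orbF => /eqP.
  by [].
apply/(@freeP _ _ _ [tuple u; x; y]) => k.
rewrite !big_ord_recl big_ord0 addr0 => /z [k0 k1 k2] i.
by case: i => [[|[|[|//]]] hi];
  [rewrite -[RHS]k0|rewrite -[RHS]k1|rewrite -[RHS]k2]; congr k; apply: val_inj.
Qed.

(** Dividing xi by lam and x, y by the square root of the absolute value of
    c lam normalises the brackets, the last one up to the sign of c. *)
Lemma lie_isomorphic_sl2_su2 (R : rcfType) (g : finDimLieAlgType R) (lam c : R)
    (xi : g) (e : g * g) :
  xi != 0 -> 0 < lam -> c != 0 -> weight_pair (lie xi) lam e -> lie e.1 e.2 = c *: xi ->
  (forall v, v \in <<[:: xi; e.1; e.2]>>%VS) ->
  lie_isomorphic g (sl R 2) \/ lie_isomorphic g (su R 2).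
Proof.
case: e => [x y] /= xi0 lam0 c0 [/= hx hy] hxy sp.
have l0 : lam != 0 by rewrite gt_eqF.
pose N := `|c * lam|.
pose k := (Num.sqrt N)^-1.
have cl0 : 0 < N by rewrite /N normr_gt0 mulf_neq0.
have k0 : k != 0 by rewrite invr_eq0 gt_eqF // sqrtr_gt0.
have k2 : k * k = N^-1 by rewrite -invfM -expr2 sqr_sqrtr // ltW.
pose u := lam^-1 *: xi.
have u0 : u != 0 by rewrite scaler_eq0 invr_eq0 (negPf l0).
have rt eps : eps * N = c * lam -> rot_triple eps u (k *: x) (k *: y).
  move=> epsE; split; rewrite /u !(lieZl, lieZr) ?hx ?hy ?hxy !scalerA.
  - by rewrite -scaleNr; congr (_ *: _); field.
  - by congr (_ *: _); field.
  - congr (_ *: _); rewrite k2.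
    by apply: (mulIf l0); rewrite divfK // -mulrA -epsE mulrCA mulVf ?mulr1 ?lt0r_neq0.
have bs eps : rot_triple eps u (k *: x) (k *: y) -> eps != 0 ->
    basis_of {:g} [:: u; k *: x; k *: y].
  move=> r e0; rewrite /basis_of (rot_triple_free r e0 u0) andbT eqEsubv subvf /=.
  apply/subvP => v _; apply: (subvP _ _ (sp v)); apply/span_subvP => w.
  have m (a : R) (z t : g) : a != 0 -> t \in [:: u; k *: x; k *: y] -> t = a *: z ->
      z \in <<[:: u; k *: x; k *: y]>>%VS.
    move=> a0 ti tE; have -> : z = a^-1 *: t by rewrite tE scalerA mulVf // scale1r.
    by rewrite memvZ // memv_span.
  rewrite !inE => /or3P[] /eqP ->.
  - by apply: (m lam^-1 _ u); rewrite ?invr_eq0 ?inE ?eqxx.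
  - by apply: (m k _ (k *: x)); rewrite ?inE ?eqxx ?orbT.
  - by apply: (m k _ (k *: y)); rewrite ?inE ?eqxx ?orbT.
have [pos|neg] := ltP 0 (c * lam).
  left; have r : rot_triple 1 u (k *: x) (k *: y) by apply: rt; rewrite mul1r /N gtr0_norm.
  by apply: lie_isomorphic_sl2 r (bs _ r _); rewrite oner_neq0.
right; have r : rot_triple (-1) u (k *: x) (k *: y).
  by apply: rt; rewrite /N ler0_norm // mulrNN mul1r.
by apply: lie_isomorphic_su2 r (bs _ r _); rewrite oppr_eq0 oner_neq0.
Qed.

Section KContact.
Variables (R : rcfType) (g : finDimLieAlgType R).
Variables (eta : {scalar g}) (xi : g) (m : {dot g for idfun}) (Phi : 'End(g)).
Hypothesis contact : metric_contact eta xi m Phi.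
Hypothesis Kc : forall x y, m (ad xi x) y = - m x (ad xi y).
Hypothesis cent : forall x, lie xi x = 0 -> exists a, x = a *: xi.

(** Both d eta and the metric are invariant under ad xi, hence so is Phi. *)
Lemma lie_xi_Phi x : lie xi (Phi x) = Phi (lie xi x).
Proof.
apply: (dot_ext (m := m)) => z.
have := eta_lie_xi contact (lie z x); rewrite lie_deriv linearD /= !(eta_lie contact).
have := Kc z (Phi x); rewrite !adE; lra.
Qed.

(** On the kernel of eta, Phi is a complex structure commuting with ad xi, so a
    weight vector p + i q splits into its Phi-eigencomponents, of real parts
    proportional to p + Phi q and p - Phi q.  On either one the imaginary part is
    y = -+ Phi x, and then eta [x, y] = -+ 2 m x x, which is nonzero when the
    component is. *)
Lemma noncommuting_weight_pair nu v : nu != 0 -> weight_pair (lie xi) nu v -> v != 0 ->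
  exists e c, [/\ weight_pair (lie xi) nu e, lie e.1 e.2 = c *: xi & c != 0].
Proof.
case: v => [p q] nu0 [/= hp hq] v0.
have ep : eta p = 0.
  apply/eqP; have := eta_lie_xi contact q; rewrite hq linearZ => /eqP.
  by rewrite mulf_eq0 (negPf nu0).
have eq : eta q = 0.
  apply/eqP; have := eta_lie_xi contact p; rewrite hp linearZ => /eqP.
  by rewrite mulf_eq0 oppr_eq0 (negPf nu0).
have P2 x : eta x = 0 -> Phi (Phi x) = - x.
  by move=> x0; rewrite (Phi_sqr contact) x0 scale0r addr0.
have eP x : eta (Phi x) = 0.
  rewrite (eta_dot contact) (Phi_skew contact).
  have -> : Phi xi = 0.
    apply/(dot_ext (m := m)) => z; rewrite dot0r; have := eta_lie contact z xi.
    rewrite lieC linearN /= (eta_lie_xi contact); lra.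
  by rewrite dot0r oppr0.
suff H (sg : R) : sg * sg = 1 -> p + sg *: Phi q != 0 ->
    exists e c, [/\ weight_pair (lie xi) nu e, lie e.1 e.2 = c *: xi & c != 0].
  have [h1|] := eqVneq (p + (1 : R) *: Phi q) 0; last by apply: H; rewrite mul1r.
  have [h2|] := eqVneq (p + (-1 : R) *: Phi q) 0; last by apply: H; rewrite mulrNN mul1r.
  case/eqP: v0.
  rewrite scale1r in h1; rewrite scaleN1r in h2.
  have p0 : p = 0.
    have : (p + Phi q) + (p - Phi q) = 0 by rewrite h1 h2 addr0.
    by rewrite addrACA subrr addr0 => /eqP;
      rewrite -mulr2n -scaler_nat scaler_eq0 pnatr_eq0 => /eqP.
  move: hp; rewrite p0 lie0r => /esym/eqP; rewrite scaler_eq0 oppr_eq0 (negPf nu0) => /eqP ->.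
  by [].
move=> sg2 x0; set x := p + _ in x0; pose y := q - sg *: Phi p.
have xw : weight_pair (lie xi) nu (x, y).
  by split; rewrite /x /y /= !(lieDr, lieNr, lieZr) !lie_xi_Phi hp hq !linearZ /=;
    apply: scalar_ext => f; rewrite !(linearD, linearN, linearZ) /= ?linearZ /=; ring.
have ex : eta x = 0 by rewrite /x linearD linearZ /= eP ep mulr0 addr0.
have yE : y = - sg *: Phi x.
  have -> : Phi x = Phi p - sg *: q by rewrite /x linearD linearZ /= P2 // scalerN.
  by rewrite scalerBr scalerA mulNr sg2 !scaleNr scale1r opprK addrC.
have [a aE] : exists a, lie x y = a *: xi.
  apply: cent; case: xw => /= h k; rewrite lie_deriv h k lieZl lieZr !liexx !scaler0 addr0 //.
exists (x, y), a; split=> //=.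
have := congr1 eta aE; rewrite linearZ /= (eta_xi contact) mulr1 yE lieZr linearZ /=.
rewrite (eta_lie contact) P2 // dotNr => <-.
have sg0 : sg != 0 by apply: contra_eq_neq sg2 => ->; rewrite mul0r eq_sym oner_neq0.
have := dot_gt0 m x0 => /lt0r_neq0 mx0.
by rewrite !(mulf_neq0, oppr_eq0, mulrN) // ?mulf_neq0 // pnatr_eq0.
Qed.

End KContact.

Theorem corollary1p2 (R : realType) (g : finDimLieAlgType R)
    (unimodular_g : unimodular g)
    (centerless_g : trivial_center g)
    (K_contact_g : exists (eta : {scalar g}) (m : {dot g for idfun})
       (Phi : 'End(g)), K_contact eta m Phi) :
  lie_isomorphic g (sl R 2) \/ lie_isomorphic g (su R 2).
Proof.
have [eta [m [Phi [xi [contact Kc]]]]] := K_contact_g.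
have cent := centralizer_xi unimodular_g centerless_g contact Kc.
have xi0 := xi_neq0 contact.
have A0 := ad_xi_neq0 centerless_g contact.
have [nu [v [vw vspan vnu]]] := skew_spectral Kc.
have w_wt mu u : weight_pair (lie xi) mu u <-> weight_pair (ad xi) mu u.
  by rewrite /weight_pair !adE.
have [j0 nuj0] : exists j, nu j != 0.
  apply/existsP; apply: contraNT A0; rewrite negb_exists => /forallP nu0.
  apply/eqP/lfunP => x; rewrite zero_lfunE; apply/eqP; rewrite -memv_ker.
  apply: vspan => j; have [[h k] _] := vw j.
  have /negPn/eqP nuj := nu0 j.
  by rewrite !memv_ker h k nuj oppr0 !scale0r !eqxx.
case: (@arg_maxP _ _ _ j0 xpredT (fun j => `|nu j|)) => // j _ jmax.
pose lam := `|nu j|.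
have lam0 : 0 < lam by apply: lt_le_trans (jmax j0 isT); rewrite normr_gt0.
have [u [uw u0]] : exists u, weight_pair (lie xi) lam u /\ u != 0.
  have [/w_wt jw j_neq0] := vw j; rewrite /lam.
  have [p|n] := ger0P (nu j); first by exists (v j).
  exists ((v j).2, (v j).1); split; first exact: weight_swap.
  apply: contraNneq j_neq0 => E; have := congr1 snd E; have := congr1 fst E.
  by case: (v j) => a b /= -> ->.
have lam_max mu w : weight_pair (lie xi) mu w -> w != 0 -> `|mu| <= lam.
  by move=> /w_wt ww w0; have [k ->] := vnu _ _ ww w0; apply: jmax.
have triple mu w := @noncommuting_weight_pair _ _ _ _ _ _ contact Kc cent mu w.
have [e [c [ew ec c0]]] := triple lam u (lt0r_neq0 lam0) uw u0.
apply: (lie_isomorphic_sl2_su2 xi0 lam0 c0 ew ec) => w.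
apply: vspan => k; have [/w_wt kw _] := vw k.
exact: (weight_span cent lam0 c0 ew ec lam_max triple xi0 kw).
Qed.
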